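(* The number of distinct quartics in an $n \times n$ array is $\mathcal{O}(n^2 \log^2 n)$.
   Context: For an array $W$ and positive integers $\alpha,\beta$, $W^{\alpha,\beta}$ denotes the array composed of $\alpha\times\beta$ copies of $W$ ($\alpha$ copies vertically, $\beta$ horizontally). A quartic is an array of the form $V^{2,2}$ for an arbitrary (not necessarily primitive) array $V$. The distinct quartics of an array $A$ are the distinct (by content) subarrays of $A$ that are quartics; occurrences at different positions with the same content count once. *)

(* Defs.v *)
From mathcomp Require Import all_boot all_order all_algebra.
From mathcomp Require Import finmap.
From mathcomp Require Import boolp classical_sets cardinality.

Set Implicit Arguments.
Unset Strict Implicit.
Unset Printing Implicit Defensive.

Local Open Scope ring_scope.
Local Open Scope classical_set_scope.

(* Two-dimensional arrays of arbitrary dimensions: Leibniz equality here is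
   equality of dimensions and of contents. *)
Definition array (T : Type) : Type := {d : nat * nat & 'M[T]_(d.1, d.2)}.

Definition to_array (T : Type) (m n : nat) (A : 'M[T]_(m, n)) : array T :=
  existT (fun d : nat * nat => 'M[T]_(d.1, d.2)) (m, n) A.

Section Repetitions.
Variable T : Type.

(* The dimensions are \sum_(i < alpha) p and \sum_(j < beta) q. *)
Definition repeat_array (alpha beta p q : nat) (W : 'M[T]_(p, q)) :=
  \mxblock_(i < alpha, j < beta) W.

Definition quartic (Q : array T) : Prop :=
  exists (p q : nat) (V : 'M[T]_(p, q)),
    [/\ (0 < p)%N, (0 < q)%N & Q = to_array (repeat_array 2 2 V)].

Section Subarrays.
Variables (m n : nat).

(* The p x q subarray of A with upper left corner (i, j). *)
Definition window (A : 'M[T]_(m, n)) (i j p q : nat)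
    (hi : (i + p <= m)%N) (hj : (j + q <= n)%N) : 'M[T]_(p, q) :=
  mxsub (fun a => widen_ord hi (rshift i a))
        (fun b => widen_ord hj (rshift j b)) A.

Definition subarray (A : 'M[T]_(m, n)) (W : array T) : Prop :=
  exists (i j p q : nat) (hi : (i + p <= m)%N) (hj : (j + q <= n)%N),
    W = to_array (window A hi hj).

Definition distinct_quartics (A : 'M[T]_(m, n)) : set (array T) :=
  [set W | subarray A W /\ quartic W].

End Subarrays.
End Repetitions.

Lemma finite_distinct_quartics (T : Type) (m n : nat) (A : 'M[T]_(m, n)) :
  finite_set (distinct_quartics A).
Proof.
pose D := ('I_m.+1 * 'I_n.+1 * ('I_m.+1 * 'I_n.+1))%type.
pose F (t : D) : set (array T) := [set W |
  exists (hi : (t.1.1 + t.2.1 <= m)%N) (hj : (t.1.2 + t.2.2 <= n)%N),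
    W = to_array (window A hi hj)].
apply: (@sub_finite_set _ _ (\bigcup_(t in [set: D]) F t)); last first.
  apply: bigcup_finite => [|t _]; first exact: finite_finset.
  have [hi|nhi] := boolP (t.1.1 + t.2.1 <= m)%N; last first.
    apply: (@sub_finite_set _ _ set0) => // W [hi _].
    by rewrite hi in nhi.
  have [hj|nhj] := boolP (t.1.2 + t.2.2 <= n)%N; last first.
    apply: (@sub_finite_set _ _ set0) => // W [_ [hj _]].
    by rewrite hj in nhj.
  apply: (@sub_finite_set _ _ [set to_array (window A hi hj)]) => //.
  by move=> W [hi' [hj' ->]]; rewrite (bool_irrelevance hi' hi)
    (bool_irrelevance hj' hj).
move=> W [[i [j [p [q [hi [hj ->]]]]]] _].
have bi : (i < m.+1)%N by rewrite ltnS (leq_trans _ hi) ?leq_addr.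
have bp : (p < m.+1)%N by rewrite ltnS (leq_trans _ hi) ?leq_addl.
have bj : (j < n.+1)%N by rewrite ltnS (leq_trans _ hj) ?leq_addr.
have bq : (q < n.+1)%N by rewrite ltnS (leq_trans _ hj) ?leq_addl.
exists ((Ordinal bi, Ordinal bj), (Ordinal bp, Ordinal bq)) => //=.
by exists hi, hj.
Qed.

(* fset_set is the empty set on infinite sets, but the set of distinct quartics
   is finite by the previous lemma. *)
Definition num_distinct_quartics (T : choiceType) (m n : nat)
    (A : 'M[T]_(m, n)) : nat :=
  #|` fset_set (distinct_quartics A) |.

(* Main.v *)
(* Every quartic is W^{2a,2b} for a primitive p x q array W. For fixed W, place
   for each a the widest quartic W^{2a,2b} somewhere in the array; it contains
   occurrences of W^{2,2} in at least a rows and b columns, so rows can be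
   chosen greedily, distinct for distinct a. This maps the distinct quartics
   injectively to triples (position, p, q) of primitively rooted quartics
   W^{2,2}. At a given position, if p and q are confined to dyadic intervals,
   the three squares lemma, applied to the common columns (resp. rows), leaves
   at most two values of p and two of q. *)

Require Import Defs.
From mathcomp Require Import all_boot all_order all_algebra.
From mathcomp Require Import finmap zify ring boolp classical_sets cardinality.
From mathcomp Require Import reals exp.

Set Implicit Arguments.
Unset Strict Implicit.
Unset Printing Implicit Defensive.

(** * Periods of finite words *)

(** A word of length [L] is a prefix of a sequence, so words of different lengths need no casts. *)
Definition local_period (S : Type) (s : nat -> S) (d L : nat) : Prop :=
  forall x, x + d < L -> s (x + d) = s x.

(** Euclid's algorithm by subtraction: for [p <= q], the difference [q - p] is again a period, by
    going back [p] and then forward [q], or in the other order near the start, where [p + q <= L]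
    leaves room. *)
Lemma fine_wilf (S : Type) (s : nat -> S) p q L :
  p + q <= L -> local_period s p L -> local_period s q L ->
  local_period s (gcdn p q) L.
Proof.
have [k] := ubnP (p + q); elim: k p q => // k IH p q.
wlog lepq : p q / p <= q => [H|].
  move=> lek leL sp sq; have [/H|/ltnW/H] := leqP p q; first exact.
  by rewrite gcdnC; apply => //; rewrite addnC.
case: p lepq => [|p] lepq lek leL sp sq; first by rewrite gcd0n.
rewrite -(subnKC lepq) gcdnDl; apply: IH => //; try lia.
move=> x ltxL; have [ltpx|lexp] := leqP p.+1 x.
  have -> : s x = s (x - p.+1) by rewrite -[in LHS](subnK ltpx) sp //; lia.
  rewrite -[RHS]sq; last lia.
  by congr s; lia.
rewrite -sp; last lia.
rewrite -[RHS]sq; last lia.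
by congr s; lia.
Qed.

Lemma local_period_leq (S : Type) (s : nat -> S) d L M :
  M <= L -> local_period s d L -> local_period s d M.
Proof. by move=> leM sd x ltx; apply: sd; apply: leq_trans leM. Qed.


Lemma local_period_mod (S : Type) (s : nat -> S) d L x :
  local_period s d L -> x < L -> s x = s (x %% d).
Proof.
move=> sd; elim/ltn_ind: x => x IH ltx.
have [ltxd|ledx] := ltnP x d; first by rewrite modn_small.
have [->|d_gt0] := posnP d; first by rewrite modn0.
have E : s x = s (x - d) by rewrite -[in LHS](subnK ledx) sd //; lia.
by rewrite E IH; [rewrite -[in RHS](subnK ledx) modnDr|lia..].
Qed.

(** Reduction modulo [e] lands in the part known to have period [d]; as [d %| e], reducing further
    modulo [d] gives the residue modulo [d]. *)
Lemma local_period_extend (S : Type) (s : nat -> S) d e L M :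
  0 < e -> d %| e -> e <= L -> local_period s d L -> local_period s e M ->
  local_period s d M.
Proof.
move=> e_gt0 de leL sd se.
suff E x : x < M -> s x = s (x %% d).
  by move=> x ltx; rewrite E // modnDr -E //; lia.
move=> ltx; rewrite (local_period_mod se ltx).
rewrite (local_period_mod sd) ?modn_dvdm //.
by apply: leq_trans leL; rewrite ltn_mod.
Qed.

(* With delta = p2 - p1 and epsilon = p3 - p2, the prefix u of length p1 has
   periods delta and epsilon, hence g = gcd delta epsilon; as g divides
   epsilon, the prefix v of length p2 also has period g. Since v is a prefix
   of uu, it has period p1 too. *)
Lemma three_squares (S : Type) (s : nat -> S) p1 p2 p3 :
  p1 < p2 < p3 -> p3 <= 2 * p1 ->
  local_period s p1 (2 * p1) -> local_period s p2 (2 * p2) ->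
  local_period s p3 (2 * p3) ->
  local_period s (gcdn (gcdn (p2 - p1) (p3 - p2)) p1) (2 * p1).
Proof.
move=> /andP[lt12 lt23] le31 s1 s2 s3.
have diff p q : p < q <= 2 * p -> local_period s p (2 * p) ->
    local_period s q (2 * q) -> local_period s (q - p) p.
  move=> /andP[ltpq leqp] sp sq x ltx; rewrite -[RHS]sq; last lia.
  by rewrite -sp; [congr s|]; lia.
have s12 : local_period s (p2 - p1) p1 by apply: diff => //; lia.
have s23 : local_period s (p3 - p2) p2 by apply: diff => //; lia.
set g := gcdn (p2 - p1) (p3 - p2).
have g_le : g <= p2 - p1 by rewrite dvdn_leq ?dvdn_gcdl //; lia.
have gp1 : local_period s g p1.
  apply: fine_wilf => //; first lia.
  by apply: local_period_leq s23; lia.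
have gp2 : local_period s g p2.
  by apply: (local_period_extend _ _ _ gp1 s23); rewrite ?dvdn_gcdr //; lia.
apply: (@local_period_extend _ _ _ p1 p2) => //; rewrite ?dvdn_gcdr //; try lia.
apply: fine_wilf => //; first lia.
by apply: local_period_leq s1; lia.
Qed.

(** * Periods of infinite sequences *)

Definition period (S : Type) (f : nat -> S) (p : nat) : Prop :=
  forall x, f (x + p) = f x.

Definition least_period (S : Type) (f : nat -> S) (p : nat) : Prop :=
  [/\ 0 < p, period f p & forall d, 0 < d -> period f d -> p <= d].

Lemma period_mod (S : Type) (f : nat -> S) p x : period f p -> f x = f (x %% p).
Proof.
by move=> fp; apply: (@local_period_mod _ _ _ x.+1) => // y _; apply: fp.
Qed.

Lemma period_mul (S : Type) (f : nat -> S) p k x :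
  period f p -> f (x + k * p) = f x.
Proof. by move=> fp; rewrite (period_mod _ fp) addnC modnMDl -period_mod. Qed.

(** The remainder of [h] modulo the least period is itself a period, so it vanishes by
    minimality. *)
Lemma least_period_exists (S : Type) (f : nat -> S) h :
  0 < h -> period f h -> exists2 p, least_period f p & p %| h.
Proof.
move=> h_gt0 fh.
have ex : exists p, (0 < p) && `[< period f p >].
  by exists h; rewrite h_gt0; apply/asboolP.
have [p /andP[p_gt0 /asboolP fp] p_min] := ex_minnP ex.
have fmin d : 0 < d -> period f d -> p <= d.
  by move=> d_gt0 fd; apply: p_min; rewrite d_gt0; apply/asboolP.
exists p => //; rewrite /dvdn; case: (posnP (h %% p)) => // r_gt0.
have := fmin _ r_gt0; rewrite leqNgt ltn_mod p_gt0; apply=> x.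
by rewrite -(period_mul (h %/ p) _ fp) -addnA [_ %% _ + _]addnC -divn_eq.
Qed.

(** * Primitively rooted quartics sharing a corner *)

Section Occurrences.
Variable T : Type.
Implicit Types (g W : nat -> nat -> T).

Definition flip (g : nat -> nat -> T) : nat -> nat -> T := fun x y => g y x.

Definition agree g W i j h w : Prop :=
  forall x y, x < h -> y < w -> g (i + x) (j + y) = W x y.

(* W is the doubly periodic extension of a primitive p x q block. *)
Definition primitive_root W p q : Prop :=
  least_period W p /\ least_period (flip W) q.

Definition primitive_quartic g i j p q : Prop :=
  exists2 W, primitive_root W p q & agree g W i j (2 * p) (2 * q).

Lemma primitive_quartic_flip g i j p q :
  primitive_quartic g i j p q -> primitive_quartic (flip g) j i q p.
Proof.
by case=> W [Wp Wq] gW; exists (flip W) => // x y ltx lty; apply: gW.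
Qed.

Lemma primitive_root_mod W p q x y :
  primitive_root W p q -> W x y = W (x %% p) (y %% q).
Proof.
move=> [[_ Wp _] [_ Wq _]]; rewrite (period_mod _ Wp).
exact: (congr1 (fun f => f (x %% p)) (period_mod y Wq)).
Qed.

(** The first [q1] columns are common to all three quartics. The three squares lemma in each of them
    gives a vertical period [d < p1]; the horizontal period [q1] spreads it to all of [W1], against
    the minimality of [p1]. *)
Lemma no_three_heights g i j p1 q1 p2 q2 p3 q3 :
  p1 < p2 < p3 -> p3 <= 2 * p1 -> q1 <= 2 * q2 -> q1 <= 2 * q3 ->
  primitive_quartic g i j p1 q1 -> primitive_quartic g i j p2 q2 ->
  primitive_quartic g i j p3 q3 -> False.
Proof.
move=> lt123 le31 le12 le13 [W1 root1 g1] [W2 root2 g2] [W3 root3 g3].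
have gper W p q y : primitive_root W p q -> agree g W i j (2 * p) (2 * q) ->
    y < 2 * q -> local_period (fun x => g (i + x) (j + y)) p (2 * p).
  move=> [[_ Wp _] _] gW lty x ltx.
  by rewrite !gW //; [rewrite Wp | lia].
set d := gcdn (gcdn (p2 - p1) (p3 - p2)) p1.
have [[p1_gt0 _ p1_min] [q1_gt0 _ _]] := root1.
have d_gt0 : 0 < d by rewrite gcdn_gt0 p1_gt0 orbT.
have ltd : d < p1.
  suff : d <= p2 - p1 by lia.
  by apply: dvdn_leq; [lia | exact: dvdn_trans (dvdn_gcdl _ _) (dvdn_gcdl _ _)].
have gd y : y < q1 -> local_period (fun x => g (i + x) (j + y)) d (2 * p1).
  move=> lty; have [l1 l2 l3] : [/\ y < 2 * q1, y < 2 * q2 & y < 2 * q3].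
    by split; lia.
  exact: three_squares lt123 le31 (gper _ _ _ _ root1 g1 l1)
    (gper _ _ _ _ root2 g2 l2) (gper _ _ _ _ root3 g3 l3).
suff /(p1_min d d_gt0) : period W1 d by lia.
move=> x; apply/funext=> y.
have ltx : x %% p1 < p1 by rewrite ltn_mod.
have lty : y %% q1 < q1 by rewrite ltn_mod.
(* Since [x %% p1 + d < 2 * p1], both entries can be read off the occurrence of [W1] in [g]. *)
rewrite (primitive_root_mod _ _ root1) -modnDml -(modn_mod y).
rewrite -(primitive_root_mod _ _ root1) [RHS](primitive_root_mod _ _ root1).
rewrite -!g1; try lia.
rewrite addnA -[RHS](gd _ lty); last lia.
by congr g; lia.
Qed.

Lemma no_three_widths g i j p1 q1 p2 q2 p3 q3 :
  q1 < q2 < q3 -> q3 <= 2 * q1 -> p1 <= 2 * p2 -> p1 <= 2 * p3 ->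
  primitive_quartic g i j p1 q1 -> primitive_quartic g i j p2 q2 ->
  primitive_quartic g i j p3 q3 -> False.
Proof.
move=> lt123 le31 le12 le13 /primitive_quartic_flip Q1.
move=> /primitive_quartic_flip Q2 /primitive_quartic_flip Q3.
exact: no_three_heights lt123 le31 le12 le13 Q1 Q2 Q3.
Qed.

End Occurrences.

(** * Counting primitively rooted quartics *)

Lemma card_leq_fibers (I J : finType) (f : I -> J) (S : {set I}) c :
  (forall y, #|[set x in S | f x == y]| <= c) -> #|S| <= c * #|J|.
Proof.
move=> fib; rewrite -sum1_card (partition_big f xpredT) //=.
rewrite mulnC -sum_nat_const.
by apply: leq_sum => y _; rewrite sum1dep_card.
Qed.

Lemma card_leq2 n (S : {set 'I_n}) :
  (forall x y z : 'I_n, x \in S -> y \in S -> z \in S -> x < y < z -> False) ->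
  #|S| <= 2.
Proof.
move=> no3; rewrite leqNgt; apply/negP => /card_gt2P[x [y [z [[Sx Sy Sz]]]]].
rewrite -!val_eqE /= => -[xy yz zx].
have [lxy|lxy|/eqP] := ltngtP x y; last by rewrite (negPf xy).
all: have [lyz|lyz|/eqP] := ltngtP y z; last by rewrite (negPf yz).
all: have [lzx|lzx|/eqP] := ltngtP z x; last by rewrite (negPf zx).
all: try lia.
- by apply: (no3 x y z) => //; rewrite lxy.
- by apply: (no3 z x y) => //; rewrite lzx.
- by apply: (no3 x z y) => //; rewrite lzx.
- by apply: (no3 y z x) => //; rewrite lyz.
- by apply: (no3 y x z) => //; rewrite lxy.
- by apply: (no3 z y x) => //; rewrite lyz.
Qed.

Definition primitive_roots_at (T : Type) (g : nat -> nat -> T) n i j :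
    {set 'I_n * 'I_n} :=
  [set t : 'I_n * 'I_n | `[< primitive_quartic g i j t.1 t.2 >]].

(** A dyadic class of pairs lies in the product of its two projections, each with at most two
    elements, hence the factor 4. *)
Lemma card_primitive_roots_at (T : Type) (g : nat -> nat -> T) n i j :
  #|primitive_roots_at g n i j| <= 4 * (trunc_log 2 n).+1 ^ 2.
Proof.
pose lvl (p : 'I_n) : 'I_(trunc_log 2 n).+1 := inord (trunc_log 2 p).
have lvlP (p : 'I_n) : 0 < p -> 2 ^ lvl p <= p < 2 * 2 ^ lvl p.
  have lt_log : trunc_log 2 p < (trunc_log 2 n).+1.
    by rewrite ltnS; apply: leq_trunc_log; apply: ltnW.
  by move=> p_gt0; rewrite (inordK lt_log) -expnS; apply: trunc_log_bounds.
pose f (t : 'I_n * 'I_n) := (lvl t.1, lvl t.2).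
rewrite -mulnn -{1 2}(card_ord (trunc_log 2 n).+1) -card_prod.
apply: (card_leq_fibers (f := f)) => -[k l].
set B := [set _ in _ | _].
have BP t : t \in B -> [/\ primitive_quartic g i j t.1 t.2,
    2 ^ k <= t.1 < 2 * 2 ^ k & 2 ^ l <= t.2 < 2 * 2 ^ l].
  rewrite !inE => /andP[/asboolP gt /eqP[<- <-]].
  have [W [[p_gt0 _ _] [q_gt0 _ _]] _] := gt.
  by split => //; apply: lvlP.
apply: (@leq_trans (#|finset.setX (fst @: B) (snd @: B)|)).
  apply: subset_leq_card; apply/fintype.subsetP => t tB.
  by rewrite inE; apply/andP; split; apply: imset_f.
rewrite cardsX (@leq_mul _ _ 2 2) //; apply: card_leq2.
  move=> x y z /imsetP[t1 /BP[Q1 /andP[a1 b1] /andP[c1 d1]] ->].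
  move=> /imsetP[t2 /BP[Q2 /andP[a2 b2] /andP[c2 d2]] ->].
  move=> /imsetP[t3 /BP[Q3 /andP[a3 b3] /andP[c3 d3]] ->] lt.
  by apply: no_three_heights lt _ _ _ Q1 Q2 Q3; lia.
move=> x y z /imsetP[t1 /BP[Q1 /andP[a1 b1] /andP[c1 d1]] ->].
move=> /imsetP[t2 /BP[Q2 /andP[a2 b2] /andP[c2 d2]] ->].
move=> /imsetP[t3 /BP[Q3 /andP[a3 b3] /andP[c3 d3]] ->] lt.
by apply: no_three_widths lt _ _ _ Q1 Q2 Q3; lia.
Qed.

Definition primitive_quartics (T : Type) (g : nat -> nat -> T) n :
    {set ('I_n * 'I_n) * ('I_n * 'I_n)} :=
  [set t : ('I_n * 'I_n) * ('I_n * 'I_n) |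
    `[< primitive_quartic g t.1.1 t.1.2 t.2.1 t.2.2 >]].

Lemma card_primitive_quartics (T : Type) (g : nat -> nat -> T) n :
  #|primitive_quartics g n| <= 4 * (trunc_log 2 n).+1 ^ 2 * n ^ 2.
Proof.
have := @card_leq_fibers _ _ fst (primitive_quartics g n)
  (4 * (trunc_log 2 n).+1 ^ 2).
rewrite card_prod card_ord mulnn; apply=> -[i j].
apply: leq_trans (card_primitive_roots_at g n i j).
have inj : injective (fun t : 'I_n * 'I_n => ((i, j), t)) by move=> ? ? [].
rewrite -[leqRHS](card_imset _ inj).
apply: subset_leq_card; apply/fintype.subsetP => -[[i' j'] t].
move=> /setIdP[/[!inE] /= gt /eqP[iE jE]]; rewrite iE jE in gt *.
by apply/imsetP; exists t; rewrite ?inE.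
Qed.

(** * Charging powers of a root to its occurrences *)

(** The [n] values already chosen cannot exhaust [X n], which has more than [n] members. *)
Lemma greedy_representatives (X : nat -> seq nat) n :
  (forall a, uniq (X a)) -> (forall a, a < size (X a)) ->
  exists x : nat -> nat, (forall a, a < n -> x a \in X a) /\
    (forall a b, a < n -> b < n -> x a = x b -> a = b).
Proof.
move=> uX sX; elim: n => [|n [x [xX x_inj]]]; first by exists id.
have [y yX yx] : exists2 y, y \in X n & y \notin map x (iota 0 n).
  apply/hasP; rewrite -[has _ _]negbK -all_predC; apply/negP => /allP sub.
  have /(uniq_leq_size (uX n)) : {subset X n <= map x (iota 0 n)}.
    by move=> z /sub /=; rewrite negbK.
  by rewrite size_map size_iota leqNgt sX.
have y_new a : a < n -> y <> x a.
  by move=> lta yE; move: yx; rewrite yE map_f // mem_iota add0n.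
exists (fun a => if a == n then y else x a); split=> [a|a b].
  by rewrite ltnS leq_eqVlt; case: eqP => [->|_] //=; apply: xX.
have lt_neq c : c < n.+1 -> c != n -> c < n by lia.
move=> /lt_neq lta /lt_neq ltb; move: lta ltb.
case: (eqVneq a n) => [->|_] lta; case: (eqVneq b n) => [->|_] ltb //.
- by move=> yb; case: (y_new _ (ltb isT)).
- by move=> /esym ya; case: (y_new _ (lta isT)).
- by apply: x_inj; [apply: lta | apply: ltb].
Qed.

Section Powers.
Variables (T : Type) (g : nat -> nat -> T) (n : nat).

(* The arrays W^{2(a+1), 2(b+1)}: shifting the exponents by one avoids
   positivity side conditions. *)
Definition occurs W p q a b : Prop :=
  exists i j, [/\ i + 2 * (a.+1 * p) <= n, j + 2 * (b.+1 * q) <= n &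
    agree g W i j (2 * (a.+1 * p)) (2 * (b.+1 * q))].

(** The four bounds let position and root dimensions be coded in ['I_n] without loss. *)
Definition root_at W p q i j : Prop :=
  [/\ p < n, q < n, i < n, j < n & agree g W i j (2 * p) (2 * q)].

(** The corner [ij] depends on [a] alone: it comes from the largest [b] that occurs. A shift by at
    most [a] root heights and that many root widths leaves room for W^{2,2}, and periodicity
    preserves the content. *)
Lemma widest_occurrence W p q a : primitive_root W p q ->
  exists ij : nat * nat, forall b, occurs W p q a b ->
  forall t, t <= a -> root_at W p q (ij.1 + t * p) (ij.2 + b * q).
Proof.
move=> [[p_gt0 Wp _] [q_gt0 Wq _]].
have [[b0 occ0]|nocc] := pselect (exists b, occurs W p q a b); last first.
  by exists (0, 0) => b occ; case: nocc; exists b.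
have ex : exists b, `[< occurs W p q a b >] by exists b0; apply/asboolP.
have bnd b : `[< occurs W p q a b >] -> b <= n.
  by move=> /asboolP[i [j [_ lej _]]]; nia.
have [B /asboolP[i [j [lei lej gW]]] B_max] := ex_maxnP ex bnd.
exists (i, j) => b /asboolP/B_max lebB t leta /=.
split; [nia..|] => x y ltx lty.
rewrite -!addnA gW; [|nia..].
rewrite addnC period_mul // addnC.
exact: (congr1 (fun f => f x) (period_mul b y Wq)).
Qed.

(* The array W^{2(a+1), 2(b+1)} is charged to an occurrence of W^{2,2} inside
   the widest occurrence with a given height: there are a+1 possible rows, so
   distinct rows can be chosen greedily for distinct a. *)
Lemma charging W p q : primitive_root W p q ->
  exists phi : nat * nat -> nat * nat,
    (forall a b, occurs W p q a b ->
      root_at W p q (phi (a, b)).1 (phi (a, b)).2) /\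
    (forall a b a' b', occurs W p q a b -> occurs W p q a' b' ->
      phi (a, b) = phi (a', b') -> (a, b) = (a', b')).
Proof.
move=> root; have [[p_gt0 _ _] [q_gt0 _ _]] := root.
have [c cP] := choice (fun a => widest_occurrence a root).
pose X a := [seq (c a).1 + t * p | t <- iota 0 a.+1].
have uX a : uniq (X a).
  by rewrite map_inj_uniq ?iota_uniq // => t u /addnI/eqP;
    rewrite eqn_pmul2r // => /eqP.
have sX a : a < size (X a) by rewrite size_map size_iota.
have [x [xX x_inj]] := greedy_representatives n uX sX.
have lta a b : occurs W p q a b -> a < n.
  by move=> [i [j [lei _ _]]]; nia.
(* The row determines [a]; with [a] known, the column determines [b]. *)
exists (fun ab => (x ab.1, (c ab.1).2 + ab.2 * q)).
split=> [a b occ /=|a b a' b' occ occ' /= [/x_inj eqa]].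
  have /mapP[t + ->] := xX _ (lta _ _ occ).
  by rewrite mem_iota add0n ltnS => leta; apply: cP.
rewrite eqa; [|exact: lta occ|exact: lta occ'] => /addnI/eqP.
by rewrite eqn_pmul2r // => /eqP->.
Qed.

End Powers.

(** * From matrices to doubly periodic functions *)

Section Quartics.
Variable T : Type.

Definition pattern (W : nat -> nat -> T) (h w : nat) : array T :=
  to_array (\matrix_(x < h, y < w) W x y).

Lemma eq_pattern (m n h w : nat) (M : 'M[T]_(m, n)) (W : nat -> nat -> T) :
  m = h -> n = w -> (forall a b, M a b = W a b) -> to_array M = pattern W h w.
Proof.
move=> <- <- MW; rewrite /pattern; congr to_array.
by apply/matrixP => a b; rewrite mxE.
Qed.

Lemma to_array_eq_pattern (m n h w : nat) (M : 'M[T]_(m, n))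
    (W : nat -> nat -> T) : to_array M = pattern W h w ->
  [/\ m = h, n = w & forall a b, M a b = W a b].
Proof.
(* Comparing entries through the values of their indices avoids transport along the equality of
   dimensions. *)
have gen (Q Q' : array T) : Q = Q' -> [/\ (projT1 Q).1 = (projT1 Q').1,
    (projT1 Q).2 = (projT1 Q').2 & forall a b a' b', val a = val a' ->
      val b = val b' -> projT2 Q a b = projT2 Q' a' b'].
  by move=> <-; split=> // a b a' b' /val_inj-> /val_inj->.
move=> /gen[/= mE nE MW]; split=> // a b.
by rewrite (MW a b (cast_ord mE a) (cast_ord nE b)) //= mxE.
Qed.

Lemma val_sig2_const (k p : nat) (s : 'I_(\sum_(i < k) p)) :
  val (tagnat.sig2 s) = s %% p.
Proof.
by rewrite [in RHS](tagnat.rect s) sum_nat_const modnMDl modn_small //.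
Qed.

Lemma repeat_array_pattern (h w : nat) (V : 'M[T]_(h.+1, w.+1)) :
  to_array (repeat_array 2 2 V) =
  pattern (fun x y => V (inord (x %% h.+1)) (inord (y %% w.+1)))
    (2 * h.+1) (2 * w.+1).
Proof.
apply: eq_pattern => [||a b]; [by rewrite sum_nat_const card_ord..|].
rewrite mxE; apply: (f_equal2 (fun_of_matrix V)); apply: val_inj;
  by rewrite /= inordK ?ltn_mod ?val_sig2_const.
Qed.

(** The least periods of the periodic extension of [V] divide the dimensions of [V]; the quotients
    are positive because [V] is nonempty. *)
Lemma quartic_primitive_root (Q : array T) : quartic Q ->
  exists W p q a b, primitive_root W p q /\
    Q = pattern W (2 * (a.+1 * p)) (2 * (b.+1 * q)).
Proof.
move=> [[|h] [[|w] [V [// _ // _ ->]]]]; rewrite repeat_array_pattern.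
set W : nat -> nat -> T := fun x y => V (inord _) (inord _).
have Wh : period W h.+1 by move=> x; rewrite /W modnDr.
have Ww : period (flip W) w.+1 by move=> x; rewrite /flip/W modnDr.
have [p Wp /dvdnP[[|a] hE]] := least_period_exists (ltn0Sn h) Wh; first by [].
have [q Wq /dvdnP[[|b] wE]] := least_period_exists (ltn0Sn w) Ww; first by [].
by exists W, p, q, a, b; rewrite -hE -wE.
Qed.

(** Out of range, [inord] falls back to index 0. Quartics reaching beyond the array may thus be
    counted too; this is harmless, as [card_primitive_quartics] holds for every function. *)
Definition entry (n : nat) (A : 'M[T]_n.+1) (i j : nat) : T :=
  A (inord i) (inord j).

Lemma distinct_quartics_occurs (n : nat) (A : 'M[T]_n.+1) (Q : array T) :
  distinct_quartics A Q -> exists W p q a b, [/\ primitive_root W p q,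
    occurs (entry A) n.+1 W p q a b &
    Q = pattern W (2 * (a.+1 * p)) (2 * (b.+1 * q))].
Proof.
move=> [[i [j [h [w [hi [hj ->]]]]]]] /quartic_primitive_root.
move=> [W [p [q [a [b [root QE]]]]]]; exists W, p, q, a, b; split=> //.
have [hE wE AW] := to_array_eq_pattern QE.
exists i, j; rewrite -hE -wE; split=> // x y ltx lty.
rewrite -(AW (Ordinal ltx) (Ordinal lty)) mxE.
by apply: (f_equal2 (fun_of_matrix A)); apply: val_inj;
  rewrite /= inordK //; lia.
Qed.

End Quartics.

(** * The injection and the final estimate *)

Lemma num_distinct_quartics_leq (T : choiceType) (n : nat) (A : 'M[T]_n.+1) :
  num_distinct_quartics A <= #|primitive_quartics (entry A) n.+1|.
Proof.
set g := entry A.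
pose K := ((nat -> nat -> T) * (nat * nat))%type.
(* The charging is fixed per root, before any quartic is considered, so that quartics with the same
   root share one [phi]. *)
have chargeK (k : K) : exists phi : nat * nat -> nat * nat,
    primitive_root k.1 k.2.1 k.2.2 ->
    (forall a b, occurs g n.+1 k.1 k.2.1 k.2.2 a b ->
      root_at g n.+1 k.1 k.2.1 k.2.2 (phi (a, b)).1 (phi (a, b)).2) /\
    (forall a b a' b', occurs g n.+1 k.1 k.2.1 k.2.2 a b ->
      occurs g n.+1 k.1 k.2.1 k.2.2 a' b' ->
      phi (a, b) = phi (a', b') -> (a, b) = (a', b')).
  have [root|nroot] := pselect (primitive_root k.1 k.2.1 k.2.2).
    by have [phi phiP] := charging g n.+1 root; exists phi.
  by exists id => root; case: nroot.
have [phi phiP] := choice chargeK.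
have decQ (Q : array T) : exists d : K * (nat * nat), distinct_quartics A Q ->
    [/\ primitive_root d.1.1 d.1.2.1 d.1.2.2,
      occurs g n.+1 d.1.1 d.1.2.1 d.1.2.2 d.2.1 d.2.2 &
      Q = pattern d.1.1 (2 * (d.2.1.+1 * d.1.2.1)) (2 * (d.2.2.+1 * d.1.2.2))].
  have [QA|nQA] := pselect (distinct_quartics A Q); last first.
    by exists ((fun _ _ => A ord0 ord0, (0, 0)), (0, 0)) => QA; case: nQA.
  have [W [p [q [a [b [root occ QE]]]]]] := distinct_quartics_occurs QA.
  by exists ((W, (p, q)), (a, b)).
have [d dP] := choice decQ.
pose F Q : ('I_n.+1 * 'I_n.+1) * ('I_n.+1 * 'I_n.+1) :=
  let: (k, ab) := d Q in let: ij := phi k ab in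
  ((inord ij.1, inord ij.2), (inord k.2.1, inord k.2.2)).
have memD Q : Q \in fset_set (distinct_quartics A) -> distinct_quartics A Q.
  by rewrite in_fset_set ?inE //; apply: finite_distinct_quartics.
rewrite /num_distinct_quartics -(size_map F) cardE; apply: uniq_leq_size.
  rewrite map_inj_in_uniq ?fset_uniq // => Q Q' /memD/dP + /memD/dP.
  rewrite /F; case: (d Q) (d Q') => [[W [p q]] [a b]] [[W' [p' q']] [a' b']] /=.
  move=> [root occ ->] [root' occ' ->].
  have [at_root phi_inj] := phiP (W, (p, q)) root.
  have [at_root' _] := phiP (W', (p', q')) root'.
  move: (at_root _ _ occ) (at_root' _ _ occ') => /=.
  case E: (phi _ _) => [i j]; case E': (phi _ _) => [i' j'] /=.
  move=> [ltp ltq lti ltj gW] [ltp' ltq' lti' ltj' gW'].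
  move=> [/(congr1 val) + /(congr1 val) + /(congr1 val) + /(congr1 val)].
  rewrite /= !inordK // => ii jj pp qq; subst i' j' p' q'.
  (* Both roots are read from the same block of [g], so they coincide. *)
  have WW : W = W'.
    have [[p_gt0 _ _] [q_gt0 _ _]] := root.
    apply/funext=> x; apply/funext=> y.
    rewrite (primitive_root_mod _ _ root) (primitive_root_mod _ _ root').
    have ltx := ltn_pmod x p_gt0; have lty := ltn_pmod y q_gt0.
    by rewrite -gW ?gW' //; lia.
  subst W'.
  by have [-> ->] := phi_inj _ _ _ _ occ occ' (etrans E (esym E')).
move=> _ /mapP[Q /memD/dP + ->]; rewrite mem_enum inE /F.
case: (d Q) => [[W [p q]] [a b]] /= [root occ _].
have [at_root _] := phiP (W, (p, q)) root.
have /= [ltp ltq lti ltj gW] := at_root _ _ occ.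
by apply/asboolP; exists W; rewrite !inordK.
Qed.

Import Order.TTheory GRing.Theory Num.Theory.
Local Open Scope ring_scope.

Theorem theorem15 (R : realType) :
  exists (C : R) (N : nat),
    forall n : nat, (N <= n)%N ->
    forall (T : choiceType) (A : 'M[T]_(n, n)),
      (num_distinct_quartics A)%:R <= C * (n%:R ^+ 2 * ln n%:R ^+ 2).
Proof.
have ln2_gt0 : 0 < ln 2 :> R by rewrite ln_gt0 // ltr1n.
(* The constant is [4 * 2 ^ 2]: the 4 is from the count, and the 2 absorbs the successor of the
   logarithm, since [1 <= ln n / ln 2] from 2 on. *)
exists (16 / ln 2 ^+ 2), 2%N => -[//|n] n_ge2 T A.
have logn : (trunc_log 2 n.+1).+1%:R <= 2 * (ln n.+1%:R / ln 2) :> R.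
  have ln2n : ln 2 <= ln n.+1%:R :> R.
    by rewrite ler_ln ?posrE ?ltr0n // ler_nat.
  rewrite mulrDl mul1r -natr1 lerD //; last by rewrite ler_pdivlMr // mul1r.
  rewrite ler_pdivlMr // mulr_natl -lnXn // ler_ln ?posrE ?exprn_gt0 //.
  by rewrite -natrX ler_nat trunc_logP.
have := leq_trans (num_distinct_quartics_leq A)
  (card_primitive_quartics (entry A) n.+1).
rewrite -(ler_nat R) => /le_trans; apply; rewrite natrM natrX natrM natrX.
rewrite [leRHS]mulrCA [leLHS]mulrC ler_wpM2l ?exprn_ge0 //.
have -> : 16 / ln 2 ^+ 2 * ln n.+1%:R ^+ 2 =
    4 * (2 * (ln n.+1%:R / ln 2)) ^+ 2 :> R.
  by field; rewrite gt_eqF.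
have r_ge0 := le_trans (ler0n R _) logn.
by rewrite ler_wpM2l // lerXn2r // nnegrE ler0n.
Qed.
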